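(* Let $\mathcal{A}$ be a unital associative algebra over $\mathbb{C}$, let $M$ be a finite-dimensional simple $\mathcal{A}$-module with action $\rho:\mathcal{A}\to \mathrm{End}_{\mathbb{C}}(M)$, and let $\widehat{H}$ be a finite abelian subgroup of $\mathrm{Aut}(\mathcal{A})$ such that the twisted modules $M^{\eta}$ are isomorphic to $M$ for all $\eta\in\widehat{H}$. Let $H=\mathrm{Hom}(\widehat H,\mathbb{C}^* )$ and let $$M=\bigoplus_{h\in H}\big(N\otimes V^h\big)$$ be the isotypic decomposition of $M$ with respect to the action of the cyclotomic quantum torus $\mathcal{R}_q$ (as set up in the context), so that $t_i(u\otimes v^h)=t_i(u)\otimes h(\eta_i)v^h$ for $u\in N$, $v^h\in V^h$. Then, up to equivalence, thin $H$-coverings of $M$ are parametrized by one-dimensional subspaces of $N$, in the following sense: for $n\in N$, $n\neq 0$, define $$M_h=\sum_{\mathbf{a}\in\mathbb{Z}^r}\mathbf{T}^{\mathbf{a}}(n)\otimes V^{h+\gamma(\mathbf{a})}\qquad (h\in H).$$ Then $\{M_h\mid h\in H\}$ is a thin $H$-covering of $M$, and every thin $H$-covering of $M$ is equivalent to a covering of this type.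
   Context: Modules are left modules. For $\sigma\in\mathrm{Aut}(\mathcal{A})$, $M^\sigma$ is the $\mathcal{A}$-module on the space $M$ with action $\rho\circ\sigma$. The group $H=\mathrm{Hom}(\widehat H,\mathbb{C}^* )$ is written additively: $(g+h)(\sigma)=g(\sigma)h(\sigma)$. The algebra is $H$-graded by $\mathcal{A}_h=\{a\in\mathcal{A}\mid \sigma(a)=h(\sigma)a\ \text{for all }\sigma\in\widehat H\}$. An $H$-covering of $M$ is a family of subspaces $\{M_h\mid h\in H\}$ of $M$ with $\sum_h M_h=M$ and $\mathcal{A}_gM_h\subseteq M_{g+h}$ for all $g,h\in H$. It is thin if whenever $\{N_h\}$ is an $H$-covering of $M$ with $N_h\subseteq M_h$ for all $h$, then $N_h=M_h$ for all $h$. Two coverings $\{M_h\}$ and $\{M_h'\}$ are equivalent if there is a fixed $k\in H$ with $M_h=M'_{h+k}$ for all $h\in H$. Quantum torus action: let $\eta_1,\dots,\eta_r$ generate $\widehat H$, and let $T_1,\dots,T_r\in \mathrm{GL}(M)$ satisfy $\rho(\eta_j(a))=T_j\rho(a)T_j^{-1}$ for all $a\in\mathcal{A}$ (i.e. $T_j$ is an isomorphism $M\to M^{\eta_j}$). Then $T_iT_j=q_{ij}T_jT_i$ for certain roots of unity $q_{ij}$, and $t_i\mapsto T_i$ makes $M$ a module over the cyclotomic quantum torus $\mathcal{R}_q=\mathcal{R}_q\langle t_1^{\pm},\dots,t_r^{\pm}\rangle$, the unital associative algebra generated by invertible $t_1,\dots,t_r$ with relations $t_it_j=q_{ij}t_jt_i$.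 $N$ is a fixed simple $\mathcal{R}_q$-submodule of $M$. The isotypic decomposition of the $\mathcal{R}_q$-module $M$ can be written in the form $M\cong\bigoplus_{h\in H}N\otimes V^h$, with $V^h$ finite-dimensional vector spaces (possibly zero), the distinct nonzero summands $N\otimes V^h$ being the distinct isotypic components, and action $t_i(u\otimes v^h)=t_i(u)\otimes h(\eta_i)v^h$. Notation: for $\mathbf{a}\in\mathbb{Z}^r$, $\mathbf{T}^{\mathbf a}=T_1^{a_1}\cdots T_r^{a_r}$, and $\mathbf T^{\mathbf a}(n)$ for $n\in N$ is the action of $\mathbf t^{\mathbf a}=t_1^{a_1}\cdots t_r^{a_r}$ on $N$. The map $\gamma:\mathbb{Z}^r\to H$ is the (well-defined) group homomorphism given by $\gamma(\mathbf{a})(\eta_1^{b_1}\cdots\eta_r^{b_r})=\prod_{i,j=1}^r q_{ij}^{a_ib_j}$. *)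

(* Defs.v *)
From HB Require Import structures.
From mathcomp Require Import all_boot all_order all_algebra all_fingroup.
From mathcomp Require Import cyclic boolp classical_sets reals.
From mathcomp Require Export complex.

Set Implicit Arguments.
Unset Strict Implicit.
Unset Printing Implicit Defensive.

Import GRing.Theory VectorInternalTheory.
Local Open Scope ring_scope.

(* Multiplicativity and chi 1 = 1 force every value of chi to be nonzero, so  *)
(* a character is a function into F with these two properties.                *)
Definition is_character (gT : finGroupType) (F : fieldType)
    (chi : {ffun gT -> F}) : bool :=
  (chi 1%g == 1) && [forall x, forall y, chi (x * y)%g == chi x * chi y].

Record dual (gT : finGroupType) (F : fieldType) := Dual {
  dual_val :> {ffun gT -> F};
  dual_valP : is_character dual_val
}.

HB.instance Definition _ (gT : finGroupType) (F : fieldType) :=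
  [isSub for @dual_val gT F].
HB.instance Definition _ (gT : finGroupType) (F : fieldType) :=
  [Choice of dual gT F by <:].

Section Dual.
Variables (gT : finGroupType) (F : fieldType).
Implicit Types chi psi : dual gT F.

Lemma dual1 chi : chi 1%g = 1.
Proof. by case: chi => f /= /andP[/eqP]. Qed.

Lemma dualM chi x y : chi (x * y)%g = chi x * chi y.
Proof. by case: chi => f /= /andP[_ /forallP/(_ x)/forallP/(_ y)/eqP]. Qed.

Lemma dual_neq0 chi x : chi x != 0.
Proof.
apply: contraNneq (oner_neq0 F) => chi0.
by rewrite -(dual1 chi) -(mulgV x) dualM chi0 mul0r.
Qed.

Lemma dual_expn chi x n : chi (x ^+ n)%g = chi x ^+ n.
Proof. by elim: n => [|n IHn]; rewrite ?dual1 // expgS dualM IHn exprS. Qed.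

Fact dual_zero_subproof : is_character [ffun _ : gT => 1 : F].
Proof.
rewrite /is_character ffunE eqxx.
by apply/forallP => x; apply/forallP => y; rewrite !ffunE mulr1.
Qed.

Fact dual_opp_subproof chi : is_character [ffun x => (chi x)^-1].
Proof.
rewrite /is_character ffunE dual1 invr1 eqxx.
by apply/forallP => x; apply/forallP => y; rewrite !ffunE dualM invfM.
Qed.

Fact dual_add_subproof chi psi : is_character [ffun x => chi x * psi x].
Proof.
rewrite /is_character ffunE !dual1 mulr1 eqxx.
by apply/forallP => x; apply/forallP => y; rewrite !ffunE !dualM mulrACA.
Qed.

Definition dual_zero := Dual dual_zero_subproof.
Definition dual_opp chi := Dual (dual_opp_subproof chi).
Definition dual_add chi psi := Dual (dual_add_subproof chi psi).

Fact dual_addA : associative dual_add.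
Proof. by move=> f g h; apply/val_inj/ffunP => x; rewrite !ffunE mulrA. Qed.

Fact dual_addC : commutative dual_add.
Proof. by move=> f g; apply/val_inj/ffunP => x; rewrite !ffunE mulrC. Qed.

Fact dual_add0 : left_id dual_zero dual_add.
Proof. by move=> f; apply/val_inj/ffunP => x; rewrite !ffunE mul1r. Qed.

Fact dual_addN : left_inverse dual_zero dual_opp dual_add.
Proof.
by move=> f; apply/val_inj/ffunP => x; rewrite !ffunE mulVf ?dual_neq0.
Qed.

HB.instance Definition _ := GRing.isZmodule.Build (dual gT F)
  dual_addA dual_addC dual_add0 dual_addN.

Lemma dualDE chi psi x : (chi + psi) x = chi x * psi x.
Proof. by rewrite ffunE. Qed.

End Dual.

(* Over an algebraically closed field all values lie in the finite set of     *)
(* #|G|-th roots of unity, which makes the character group finite.            *)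
Section DualFinite.
Variables (gT : finGroupType) (F : closedFieldType).

Definition unity_roots : seq F :=
  sval (closed_field_poly_normal ('X^#|gT| - 1 : {poly F})).

Lemma mem_unity_roots (chi : dual gT F) x : chi x \in unity_roots.
Proof.
rewrite /unity_roots; case: closed_field_poly_normal => r /= Dr.
have gT0 : (0 < #|gT|)%N by apply/card_gt0P; exists 1%g.
have : root ('X^#|gT| - 1 : {poly F}) (chi x).
  rewrite rootE hornerD hornerN hornerC hornerXn -dual_expn.
  by rewrite -cardsT expg_cardG ?inE // dual1 subrr.
rewrite {1}Dr rootZ ?root_prod_XsubC // lead_coef_eq0.
by rewrite -size_poly_eq0 -polyC1 size_XnsubC.
Qed.

Definition dual_code (chi : dual gT F) : {ffun gT -> seq_sub unity_roots} :=
  [ffun x => SeqSub (mem_unity_roots chi x)].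

Definition dual_decode (f : {ffun gT -> seq_sub unity_roots}) :
    option (dual gT F) :=
  insub [ffun x => val (f x)].

Lemma dual_codeK : pcancel dual_code dual_decode.
Proof.
move=> chi; rewrite /dual_decode.
have -> : [ffun x => val (dual_code chi x)] = val chi.
  by apply/ffunP => x; rewrite !ffunE.
exact: valK.
Qed.

HB.instance Definition _ := Countable.copy (dual gT F) (pcan_type dual_codeK).
HB.instance Definition _ : isFinite (dual gT F) := PCanIsFinite dual_codeK.

End DualFinite.

(* A model of the tensor product of finite-dimensional spaces: tens_universal *)
(* is the universal property.                                                 *)
Definition tensor (F : fieldType) (U W : vectType F) : vectType F :=
  'M[F]_(dim U, dim W).

Definition tens (F : fieldType) (U W : vectType F) (u : U) (w : W) :
    tensor U W :=
  (v2r u)^T *m v2r w.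

Section Tensor.
Variables (F : fieldType) (U W : vectType F).

Fact tens_is_linear (u : U) : linear (tens u : W -> tensor U W).
Proof.
by move=> c w w'; rewrite /tens linearD linearZ /= mulmxDr -scalemxAr.
Qed.

HB.instance Definition _ (u : U) :=
  GRing.isLinear.Build F W (tensor U W) _ (tens u) (tens_is_linear u).

Fact tens_is_linearl (w : W) :
  linear ((fun u => tens u w) : U -> tensor U W).
Proof.
move=> c u u'; rewrite /tens.
by rewrite linearD linearZ /= linearD linearZ /= mulmxDl -scalemxAl.
Qed.

Lemma tens_universal (X : vectType F) (f : U -> W -> X) :
    (forall u, linear (f u)) -> (forall w, linear (f^~ w)) ->
  exists! g : 'Hom(tensor U W, X), forall u w, g (tens u w) = f u w.
Proof.
move=> flinr flinl.
pose fr u : {linear W -> X} :=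
  HB.pack (f u) (GRing.isLinear.Build F W X _ (f u) (flinr u)).
pose fl w : {linear U -> X} :=
  HB.pack (f^~ w) (GRing.isLinear.Build F U X _ (f^~ w) (flinl w)).
pose e i : U := r2v (delta_mx 0 i).
pose e' j : W := r2v (delta_mx 0 j).
have De u : u = \sum_i v2r u 0 i *: e i.
  rewrite -{1}(v2rK u) {1}[v2r u]row_sum_delta linear_sum.
  by apply: eq_bigr => i _; rewrite linearZ.
have De' w : w = \sum_j v2r w 0 j *: e' j.
  rewrite -{1}(v2rK w) {1}[v2r w]row_sum_delta linear_sum.
  by apply: eq_bigr => j _; rewrite linearZ.
pose g0 (t : tensor U W) : X :=
  \sum_i \sum_j (t : 'M_(_, _)) i j *: f (e i) (e' j).
have g0lin : linear g0.
  move=> c t t'; rewrite /g0 scaler_sumr -big_split; apply: eq_bigr => i _.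
  rewrite scaler_sumr -big_split; apply: eq_bigr => j _ /=.
  by rewrite !mxE scalerDl scalerA.
pose g1 : {linear tensor U W -> X} :=
  HB.pack g0 (GRing.isLinear.Build F (tensor U W) X _ g0 g0lin).
exists (linfun g1); split=> [u w | g' Dg'].
  rewrite lfunE /= /g0 {2}(De u) -[RHS]/(fl w _) linear_sum.
  apply: eq_bigr => i _; rewrite linearZ /= {2}(De' w).
  rewrite -[f (e i) _]/(fr (e i) _) linear_sum scaler_sumr.
  by apply: eq_bigr => j _; rewrite linearZ scalerA mxE big_ord1 mxE.
apply/lfunP => t; rewrite lfunE /= /g0.
rewrite [t in RHS](matrix_sum_delta (t : 'M_(_, _))) linear_sum.
apply: eq_bigr => i _; rewrite linear_sum; apply: eq_bigr => j _.
rewrite linearZ -Dg' /tens /e /e' !r2vK; congr (_ *: g' _).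
by rewrite trmx_delta mul_delta_mx.
Qed.

End Tensor.

(* The subspace u (x) W of U (x) W, W being the whole space                   *)
Definition tens_line (F : fieldType) (U W : vectType F) (u : U) :
    {vspace tensor U W} :=
  limg (linfun (tens u : W -> tensor U W)).

Definition is_vsum (F : fieldType) (M : vectType F) (I : Type)
    (X : I -> {vspace M}) (S : {vspace M}) : Prop :=
  forall x, x \in S <-> exists s : seq I, x \in (\sum_(i <- s) X i)%VS.

(* The choice is determined: see vsumP and is_vsum_uniq.                      *)
Definition vsum (F : fieldType) (M : vectType F) (I : Type)
    (X : I -> {vspace M}) : {vspace M} :=
  xget 0%VS [set S | is_vsum X S]%classic.

Section Vsum.
Variables (F : fieldType) (M : vectType F) (I : Type) (X : I -> {vspace M}).

Lemma is_vsum_uniq S S' : is_vsum X S -> is_vsum X S' -> S = S'.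
Proof.
move=> hS hS'; apply/vspaceP => x.
by apply/idP/idP => [/hS/hS'|/hS'/hS].
Qed.

Lemma vsumP : is_vsum X (vsum X).
Proof.
apply: (@xgetPex _ 0%VS [set S | is_vsum X S]%classic).
pose P n := `[< exists s : seq I, \dim (\sum_(i <- s) X i)%VS = n >].
have exP : exists n, P n.
  by exists (\dim (\sum_(i <- [::]) X i)%VS); apply/asboolP; exists [::].
have leP n : P n -> (n <= \dim {:M})%N.
  by move=> /asboolP[s <-]; rewrite dimvS ?subvf.
case: (ex_maxnP exP leP) => n /asboolP[s Ds] maxn.
exists (\sum_(i <- s) X i)%VS => x; split=> [xs|[s' xs']]; first by exists s.
have le1 : (\sum_(i <- s) X i <= \sum_(i <- s ++ s') X i)%VS.
  by rewrite big_cat /= addvSl.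
have /eqP -> : (\sum_(i <- s) X i)%VS == (\sum_(i <- s ++ s') X i)%VS.
  by rewrite eqEdim le1 Ds maxn //; apply/asboolP; exists (s ++ s').
by rewrite big_cat /=; apply: subvP xs'; rewrite addvSr.
Qed.

End Vsum.

Section Modules.
Variables (F : fieldType) (A : algType F).

Definition is_module (M : vectType F) (rho : {linear A -> 'End(M)}) : Prop :=
  rho 1 = \1%VF /\ forall a b, rho (a * b) = (rho a \o rho b)%VF.

Definition is_simple_module (M : vectType F) (rho : A -> 'End(M)) : Prop :=
  (fullv : {vspace M}) != 0%VS /\
  forall U : {vspace M},
    (forall a, (rho a @: U <= U)%VS) -> U = 0%VS \/ U = fullv.

Definition module_iso (M M' : vectType F)
    (rho : A -> 'End(M)) (rho' : A -> 'End(M')) : Prop :=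
  exists f : 'Hom(M, M'),
    bijective f /\ forall a, (f \o rho a)%VF = (rho' a \o f)%VF.

Definition twist (M : vectType F) (rho : A -> 'End(M)) (sigma : A -> A) :
    A -> 'End(M) :=
  rho \o sigma.

(* alpha embeds the group gT as a subgroup of Aut(A); each alpha s is          *)
(* invertible, with inverse alpha s^-1.                                       *)
Definition is_aut_subgroup (gT : finGroupType)
    (alpha : gT -> {lrmorphism A -> A}) : Prop :=
  [/\ alpha 1%g =1 id,
      forall s t, alpha (s * t)%g =1 alpha s \o alpha t
    & forall s t, alpha s =1 alpha t -> s = t].

Definition homogeneous (gT : finGroupType) (alpha : gT -> A -> A)
    (h : dual gT F) : set A :=
  [set a | forall s, alpha s a = h s *: a]%classic.

End Modules.

Section Coverings.
Variables (F : closedFieldType) (A : algType F) (gT : finGroupType).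
Variables (alpha : gT -> A -> A) (M : vectType F) (rho : A -> 'End(M)).
Implicit Types X Y : dual gT F -> {vspace M}.

Definition covering X : Prop :=
  (\sum_h X h)%VS = fullv /\
  forall g h a, homogeneous alpha g a -> (rho a @: X h <= X (g + h)%R)%VS.

Definition thin_covering X : Prop :=
  covering X /\
  forall Y, covering Y -> (forall h, (Y h <= X h)%VS) -> forall h, Y h = X h.

Definition equiv_covering X Y : Prop :=
  exists k : dual gT F, forall h, X h = Y (h + k).

End Coverings.

Definition expgz (gT : finGroupType) (x : gT) (z : int) : gT :=
  match z with
  | Posz n => (x ^+ n)%g
  | Negz n => (x ^- n.+1)%g
  end.

Section QuantumTorus.
Variables (F : fieldType) (M : vectType F) (r : nat).

Definition lfun_expz (f : 'End(M)) (z : int) : 'End(M) :=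
  match z with
  | Posz n => iter n (comp_lfun f) \1%VF
  | Negz n => iter n.+1 (comp_lfun (f^-1)%VF) \1%VF
  end.

(* T^a = T_1^{a_1} o ... o T_r^{a_r}, in this order                           *)
Definition monomial (T : 'I_r -> 'End(M)) (a : {ffun 'I_r -> int}) : 'End(M) :=
  (\big[@comp_lfun _ _ _ _ / \1]_(i < r) lfun_expz (T i) (a i))%VF.

(* By the presentation of the quantum torus, a module over it on M is an      *)
(* r-tuple of invertible operators satisfying the defining relations.         *)
Definition is_qtorus_module (q : 'I_r -> 'I_r -> F) (T : 'I_r -> 'End(M)) :
    Prop :=
  (forall i, lker (T i) == 0%VS) /\
  (forall i j, (T i \o T j)%VF = q i j *: (T j \o T i)%VF).

Variable T : 'I_r -> 'End(M).
Implicit Types U W : {vspace M}.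

Definition qsubmodule U : Prop :=
  forall i, (T i @: U <= U)%VS /\ ((T i)^-1 @: U <= U)%VS.

Definition qsimple U : Prop :=
  [/\ qsubmodule U, U != 0%VS
    & forall W, qsubmodule W -> (W <= U)%VS -> W = 0%VS \/ W = U].

Definition qiso U W : Prop :=
  exists f : 'End(M),
    [/\ (f @: U)%VS = W, (U :&: lker f)%VS = 0%VS
      & forall i u, u \in U -> f (T i u) = T i (f u)].

Definition isotypic_component U : Prop :=
  exists2 S, qsimple S
    & U = vsum (fun W : {W : {vspace M} | qsimple W /\ qiso W S} => sval W).

(* The action of f on the f-stable subspace N                                 *)
Definition restrict (N : {vspace M}) (f : 'End(M)) (u : subvs_of N) :
    subvs_of N :=
  vsproj N (f (vsval u)).

End QuantumTorus.

(* iota h is the restriction to the summand N (x) V^h of an isomorphism of    *)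
(* quantum torus modules from the direct sum of the N (x) V^h onto M.         *)
Record isotypic_decomposition (F : closedFieldType) (gT : finGroupType)
    (M : vectType F) (r : nat) (eta : 'I_r -> gT) (T : 'I_r -> 'End(M))
    (N : {vspace M}) (V : dual gT F -> vectType F)
    (iota : forall h, 'Hom(tensor (subvs_of N) (V h), M)) : Prop := {
  decomp_inj : forall h, lker (iota h) == 0%VS;
  decomp_direct : directv (\sum_h limg (iota h))%VS;
  decomp_full : (\sum_h limg (iota h))%VS = fullv;
  decomp_action : forall h i (u : subvs_of N) (v : V h),
    T i (iota h (tens u v))
      = iota h (tens (restrict (T i) u) (h (eta i) *: v));
  decomp_isotypic : forall U : {vspace M},
    isotypic_component T U <-> U != 0%VS /\ exists h, U = limg (iota h)
}.

(* M_h = sum over a in Z^r of T^a(n) (x) V^(h + gamma(a))                     *)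
Definition torus_covering (F : closedFieldType) (gT : finGroupType)
    (M : vectType F) (r : nat) (T : 'I_r -> 'End(M)) (N : {vspace M})
    (V : dual gT F -> vectType F)
    (iota : forall h, 'Hom(tensor (subvs_of N) (V h), M))
    (gamma : {ffun 'I_r -> int} -> dual gT F) (n : subvs_of N)
    (h : dual gT F) : {vspace M} :=
  vsum (fun a : {ffun 'I_r -> int} =>
    iota (h + gamma a)%R
      @: tens_line (V (h + gamma a)%R) (restrict (monomial T a) n))%VS.

(* Main.v *)
Require Import Defs.
From HB Require Import structures.
From mathcomp Require Import all_boot all_order all_algebra all_fingroup.
From mathcomp Require Import boolp reals.

(** Everything is governed by the operators of a given degree.  Say that an
    operator f on a space carrying T_1, ..., T_r has degree k, for a character
    k of Hhat, if T_i f = k(eta_i) f T_i for all i.  By Burnside's theorem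
    [burnside] the simple module M sees all of End(M), and averaging over Hhat
    shows that the elements of A that are homogeneous of degree g act exactly
    as the operators of degree g on M ([coveringE]).  So an H-covering is a
    family of subspaces that sums to M and is shifted correctly by the
    operators of each degree; the algebra A can be forgotten.

    On the simple torus module N the degree pieces D_k of End(N) form a graded
    division algebra: a nonzero operator of degree k has a T-stable kernel,
    hence is invertible, with inverse of degree -k ([piece_inj], [pieceV]), and
    by Schur's lemma D_k is at most a line ([piece_line]).  The monomial T^a
    lies in D_(-gamma(a)); by Burnside's theorem on N and the independence of
    weight spaces there are no other pieces, and each of these is spanned by a
    monomial ([piece_monomial]).

    Bases of the V^h cut M into copies of N, indexed by x, each with a degree
    wt(x) = h, with inclusions inj x and projections prj x.  An operator of
    degree g on M is a matrix whose (x, y) entry lies in D_(g + wt y - wt x)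
    ([entry_piece], [matrix_unit_piece]), and the covering of the theorem is

        M_h = { m | prj x m is in D_(h - wt x)(n) for all x }

    ([vector_coveringP], [torus_coveringE]).  That it is a covering is then a
    count of degrees.  The other two assertions come from one trick: if
    prj x m is a nonzero vector n, then any inj y (d n), with d of some degree,
    is the image of m under the homogeneous operator inj y o d o prj x.

    - Thinness ([vector_covering_minimal]).  A covering Y inside M_h contains
      some m with prj x m = d n nonzero, and replacing d by f d^-1 the operators
      above send m to any inj x (f n), with the correct shift of degree.
    - Classification ([vector_covering_sub]).  In any covering X choose m in
      some X_h with n = prj x m nonzero.  The operators above put a shift of
      the covering attached to n inside X, and if X is thin they are equal. *)

Set Implicit Arguments.
Unset Strict Implicit.
Unset Printing Implicit Defensive.

Import GRing.Theory VectorInternalTheory.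
Local Open Scope ring_scope.

(** * Burnside's theorem *)

Section Burnside.
Variables (F : closedFieldType) (V : vectType F).

(** Any root of the characteristic polynomial provides one. *)
Lemma eigenvector_exists (f : 'End(V)) :
  (fullv : {vspace V}) != 0%VS ->
  exists a, exists2 v, v != 0 & f v = a *: v.
Proof.
rewrite -dimv_eq0 dimvf => V0.
have /closed_rootP[a] : size (char_poly (f2mx f)) != 1%N.
  by rewrite size_char_poly eqSS.
rewrite -eigenvalue_root_char => /eigenvalueP[v vf v0].
exists a, (r2v v).
  by apply: contraNneq v0 => v0; rewrite -(r2vK v) v0 linear0.
by rewrite unlock /= r2vK vf linearZ.
Qed.

(** A predicate on operators rather than an algebra, so that the same notion
    covers an algebra of operators and a finite family of generators. *)
Definition irreducible_ops (P : 'End(V) -> Prop) : Prop :=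
  (fullv : {vspace V}) != 0%VS /\
  forall U : {vspace V},
    (forall s, P s -> (s @: U <= U)%VS) -> U = 0%VS \/ U = fullv.

(** An eigenspace of f is stable under everything that commutes with f. *)
Lemma schur_scalar (P : 'End(V) -> Prop) (f : 'End(V)) :
    irreducible_ops P -> (forall s, P s -> (s \o f = f \o s)%VF) ->
  exists c, f = c *: \1%VF.
Proof.
move=> [V0 irrP] fC; have [c [v v0 fv]] := eigenvector_exists f V0.
exists c; apply/lfunP => w.
have memE x : (x \in lker (f - c *: \1%VF)) = (f x == c *: x).
  by rewrite memv_ker !lfun_simp subr_eq0.
have stab s : P s ->
    (s @: lker (f - c *: \1%VF) <= lker (f - c *: \1%VF))%VS.
  move=> Ps; apply/subvP => _ /memv_imgP[x + ->].
  rewrite !memE => /eqP fx.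
  by rewrite -comp_lfunE -fC // comp_lfunE fx linearZ.
have [K0|KT] := irrP _ stab.
  by move: v0; rewrite -memv0 -K0 memE fv eqxx.
by apply/eqP; rewrite !lfun_simp -memE KT memvf.
Qed.

Definition lfun_eval (v : V) (f : 'End(V)) : V := f v.

Fact lfun_eval_is_linear v : linear (lfun_eval v).
Proof. by move=> c f g; rewrite /lfun_eval !lfun_simp. Qed.

HB.instance Definition _ v :=
  GRing.isLinear.Build F 'End(V) V _ (lfun_eval v) (lfun_eval_is_linear v).

Definition evalv (v : V) : 'Hom('End(V), V) := linfun (lfun_eval v).

Lemma evalvE v f : evalv v f = f v.
Proof. by rewrite lfunE. Qed.

Variable S : {vspace 'End(V)}.
Hypothesis S1 : \1%VF \in S.
Hypothesis SM : forall s t, s \in S -> t \in S -> (s \o t)%VF \in S.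
Hypothesis S_irr : irreducible_ops (fun s => s \in S).

Definition annihilator (X : seq V) : {vspace 'End(V)} :=
  (S :&: \bigcap_(x <- X) lker (evalv x))%VS.

Let mem_ann_cons x X s :
  (s \in annihilator (x :: X)) = (s \in annihilator X) && (s x == 0).
Proof.
by rewrite /annihilator big_cons !memv_cap memv_ker evalvE andbA andbAC.
Qed.

Let annS X s : s \in annihilator X -> s \in S.
Proof. by rewrite memv_cap => /andP[]. Qed.

Let ann0 X s x : s \in annihilator X -> x \in X -> s x = 0.
Proof.
elim: X => //= y X IHX; rewrite mem_ann_cons inE => /andP[/IHX sX /eqP sy].
by case/predU1P=> [->|/sX].
Qed.

Let annM X s t : s \in S -> t \in annihilator X -> (s \o t)%VF \in annihilator X.
Proof.
elim: X => [|x X IHX] in t *.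
  by rewrite /annihilator big_nil capvf; apply: SM.
move=> sS; rewrite !mem_ann_cons => /andP[tX /eqP tx].
by rewrite IHX //= comp_lfunE tx linear0.
Qed.

Let eval_annihilator X x :
  (evalv x @: annihilator X)%VS = 0%VS \/
  (evalv x @: annihilator X)%VS = fullv.
Proof.
apply: S_irr.2 => s sS; apply/subvP => _ /memv_imgP[_ /memv_imgP[t tX ->] ->].
by rewrite evalvE -comp_lfunE -evalvE memv_img // annM.
Qed.

(** Jacobson density, in the form: a vector killed by everything in S that kills
    X lies in the span of X.  In the inductive step either the annihilator of X
    kills x as well, or it maps x onto all of V; then s x |-> s v is a
    well-defined endomorphism commuting with S, so a scalar c by Schur's lemma,
    and v - c x is killed by the annihilator of X. *)
Lemma double_annihilator X v :
  (forall s, s \in annihilator X -> s v = 0) -> v \in <<X>>%VS.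
Proof.
elim: X => [|x X IHX] in v * => annv.
  rewrite span_nil memv0 -[v]id_lfunE annv //.
  by rewrite /annihilator big_nil capvf.
rewrite span_cons; have [x0|xT] := eval_annihilator X x.
  apply: (subvP (addvSr _ _)); apply: IHX => s sX; apply: annv.
  by rewrite mem_ann_cons sX /= -evalvE -memv0 -x0 memv_img.
pose g := (evalv x \o projv (annihilator X))%VF.
have gT : limg g = fullv by rewrite limg_comp limg_proj.
(* The composite of g^-1 and the projection picks, for w in V, some s in the
   annihilator of X with s x = w. *)
pose theta := (evalv v \o projv (annihilator X) \o g^-1)%VF.
have thetaE s : s \in annihilator X -> theta (s x) = s v.
  move=> sX; rewrite !comp_lfunE evalvE.
  set t := projv _ _; have tX : t \in annihilator X by rewrite memv_proj.
  have tx : t x = s x.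
    have : s x \in limg g by rewrite gT memvf.
    by move/limg_lfunVK; rewrite comp_lfunE evalvE.
  apply/eqP; rewrite -subr_eq0; apply/eqP.
  have := annv (t - s); rewrite !lfun_simp; apply.
  by rewrite mem_ann_cons rpredB //= !lfun_simp tx subrr.
clearbody theta.
have hit w : exists2 s, s \in annihilator X & w = s x.
  have : w \in fullv by rewrite memvf.
  by rewrite -xT => /memv_imgP[s sX ->]; exists s; rewrite ?evalvE.
have [c thetac] : exists c, theta = c *: \1%VF.
  apply: schur_scalar S_irr _ => s sS; apply/lfunP => w.
  have [t tX ->] := hit w.
  rewrite [LHS]comp_lfunE [RHS]comp_lfunE thetaE //.
  by rewrite -[s (t x)]comp_lfunE thetaE ?annM // comp_lfunE.
have vcx : v - c *: x \in <<X>>%VS.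
  apply: IHX => s sX.
  by rewrite linearB linearZ /= -thetaE // thetac !lfun_simp subrr.
by rewrite -(subrK (c *: x) v) addrC memv_add // memvZ ?memv_line.
Qed.

(** Operators of S interpolate any f on a free family: an error at the next
    vector x is corrected by an element of S that kills the previous ones, and
    such elements move x anywhere because x is outside their span. *)
Theorem burnside : S = fullv.
Proof.
have interp X (f : 'End(V)) : free X ->
    exists2 s, s \in S & {in X, s =1 f}.
  elim: X => [|x X IHX] /=; first by exists \1%VF.
  rewrite free_cons => /andP[xX /IHX[s sS sX]].
  have [x0|xT] := eval_annihilator X x.
    case/negP: xX; apply: double_annihilator => t tX.
    by apply/eqP; rewrite -evalvE -memv0 -x0 memv_img.
  have : f x - s x \in (evalv x @: annihilator X)%VS by rewrite xT memvf.
  case/memv_imgP=> t tX; rewrite evalvE => tx.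
  exists (s + t) => [|y]; first by rewrite rpredD // (annS tX).
  rewrite inE lfun_simp => /predU1P[->|yX]; first by rewrite -tx subrKC.
  by rewrite (ann0 tX) // addr0 sX.
apply/eqP; rewrite eqEsubv subvf; apply/subvP => f _ /=.
have [s sS sf] := interp _ f (basis_free (vbasisP {:V})).
have /(fullv_lfunP s f)[_ <-] // := span_basis (vbasisP {:V}).
Qed.

End Burnside.

(** * Simultaneous eigenspaces *)

Section WeightSpaces.
Variables (F : fieldType) (E : vectType F) (I : finType) (L : I -> 'End(E)).

Definition weight_space (c : I -> F) : {vspace E} :=
  (\bigcap_i lker (L i - c i *: \1%VF))%VS.

Lemma weight_spaceP c x :
  reflect (forall i, L i x = c i *: x) (x \in weight_space c).
Proof.
have memE i : (x \in lker (L i - c i *: \1%VF)) = (L i x == c i *: x).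
  by rewrite memv_ker !lfun_simp subr_eq0.
apply: (iffP subv_bigcapP) => [Lx i | Lx i _]; last by rewrite -memvE memE Lx.
by apply/eqP; rewrite -memE memvE Lx.
Qed.

(** For each j in s pick i separating the weights of k and j.  The operator
    L i - c j i kills the weight space of j, scales that of k by a nonzero
    factor and preserves the others, so it shortens s. *)
Lemma weight_space_seq_indep (K : eqType) (c : K -> I -> F) (s : seq K) k x :
    (forall j l, c j =1 c l -> j = l) -> k \notin s ->
    x \in weight_space (c k) -> x \in (\sum_(j <- s) weight_space (c j))%VS ->
  x = 0.
Proof.
move=> c_inj; elim: s => [|j s IHs] in x *.
  by rewrite big_nil memv0 => _ _ /eqP.
rewrite inE negb_or big_cons => /andP[kj ks] xk /memv_addP[y yj [z zs xyz]].
have [i cji] : exists i, c k i != c j i.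
  apply/existsP; apply: contraNT kj => /existsPn eq_c.
  by apply/eqP/c_inj => i; apply/eqP; rewrite -[_ == _]negbK.
pose Q : 'End(E) := L i - c j i *: \1%VF.
have QE l w : w \in weight_space (c l) -> Q w = (c l i - c j i) *: w.
  by move=> /weight_spaceP wl; rewrite !lfun_simp wl scalerBl.
have Qx : Q x = Q z by rewrite xyz linearD /= (QE j) // subrr scale0r add0r.
have : (c k i - c j i) *: x = 0.
  rewrite -(QE k) //; apply: IHs => //; first by rewrite (QE k) // memvZ.
  have : Q z \in (Q @: \sum_(l <- s) weight_space (c l))%VS by rewrite memv_img.
  rewrite Qx limg_sum; apply: subvP.
  elim: (s) => [|l s' IHs']; first by rewrite !big_nil.
  rewrite !big_cons addvS //; apply/subvP => _ /memv_imgP[w wl ->].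
  by rewrite (QE l) // memvZ.
by move/eqP; rewrite scaler_eq0 subr_eq0 (negPf cji) => /eqP.
Qed.

Lemma weight_space_indep (K : finType) (c : K -> I -> F) (G : {pred K}) k x :
    (forall j l, c j =1 c l -> j = l) -> k \notin G ->
    x \in weight_space (c k) -> x \in (\sum_(j in G) weight_space (c j))%VS ->
  x = 0.
Proof.
move=> c_inj kG xk; rewrite -big_enum /=.
by apply: weight_space_seq_indep c_inj _ xk; rewrite mem_enum.
Qed.

End WeightSpaces.

(** * Characters on generators *)

Section Generation.
Variables (gT : finGroupType) (r : nat) (eta : 'I_r -> gT).
Hypothesis eta_gen : <<[set eta i | i : 'I_r]>>%g = [set: gT].

(** The elements satisfying P form a subgroup: in a finite group closure under
    products is enough. *)
Lemma generated_ind (P : gT -> Prop) :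
    P 1%g -> (forall s t, P s -> P t -> P (s * t)%g) ->
    (forall i, P (eta i)) ->
  forall s, P s.
Proof.
move=> P1 PM Peta s; pose G := [set s | `[< P s >]].
have groupG : group_set G.
  apply/group_setP; split=> [|x y]; rewrite !inE; first exact/asboolP.
  by move=> /asboolP Px /asboolP Py; apply/asboolP/PM.
have : s \in <<[set eta i | i : 'I_r]>>%g by rewrite eta_gen inE.
suff sub : <<[set eta i | i : 'I_r]>>%g \subset Group groupG.
  by move/(subsetP sub); rewrite inE => /asboolP.
rewrite gen_subG; apply/subsetP => _ /imsetP[i _ ->].
by rewrite inE; apply/asboolP.
Qed.

Lemma dual_ext_gen (F : fieldType) (chi psi : dual gT F) :
  (forall i, chi (eta i) = psi (eta i)) -> chi = psi.
Proof.
move=> eq_eta; apply/val_inj/ffunP; apply: generated_ind => //.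
  by rewrite !dual1.
by move=> s t /= es et; rewrite !dualM es et.
Qed.

End Generation.

(** * Homogeneous operators *)

Section Conjugation.
Variables (F : fieldType) (U : vectType F).

Definition lfun_conj (t f : 'End(U)) : 'End(U) := (t \o f \o t^-1)%VF.

Fact lfun_conj_is_linear t : linear (lfun_conj t).
Proof.
move=> c f g; rewrite /lfun_conj comp_lfunDr comp_lfunDl.
by rewrite -comp_lfunZr -comp_lfunZl.
Qed.

HB.instance Definition _ t :=
  GRing.isLinear.Build F 'End(U) 'End(U) _ (lfun_conj t) (lfun_conj_is_linear t).

End Conjugation.

Section GradedPieces.
Variables (F : fieldType) (gT : finGroupType) (r : nat) (eta : 'I_r -> gT).
Variables (U : vectType F) (T : 'I_r -> 'End(U)).
Hypothesis T_inj : forall i, lker (T i) == 0%VS.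
Implicit Types (k l : dual gT F) (f g : 'End(U)).

(** The operators of degree k.  They are encoded as simultaneous eigenvectors
    of the conjugations by the T i, which makes the independence of weight
    spaces available; the commutation rule is [pieceP]. *)
Definition piece k : {vspace 'End(U)} :=
  weight_space (fun i => linfun (lfun_conj (T i))) (fun i => k (eta i)).

Lemma pieceP k f :
  reflect (forall i, (T i \o f = k (eta i) *: (f \o T i))%VF) (f \in piece k).
Proof.
apply: (iffP (weight_spaceP _ _ _)) => Tf i.
  have := Tf i; rewrite lfunE /= /lfun_conj => Tfi.
  by rewrite -[LHS](lker0_compfVK (T_inj i)) Tfi comp_lfunZl.
by rewrite lfunE /= /lfun_conj Tf -comp_lfunZl lker0_compfK.
Qed.

Lemma pieceE k f i u : f \in piece k -> T i (f u) = k (eta i) *: f (T i u).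
Proof. by move/pieceP/(_ i)/lfunP/(_ u); rewrite !lfun_simp. Qed.

Lemma piece1 : \1%VF \in piece 0.
Proof.
by apply/pieceP => i; rewrite comp_lfun1l comp_lfun1r ffunE scale1r.
Qed.

Lemma pieceM k l f g :
  f \in piece k -> g \in piece l -> (f \o g)%VF \in piece (k + l).
Proof.
move=> fk gl; apply/pieceP => i; apply/lfunP => u.
rewrite !lfun_simp (pieceE _ _ fk) (pieceE _ _ gl) linearZ scalerA.
by rewrite dualDE.
Qed.

Lemma pieceV k f : lker f == 0%VS -> f \in piece k -> (f^-1)%VF \in piece (- k).
Proof.
move=> f_inj fk; apply/pieceP => i; apply/lfunP => u.
have /lker0P := f_inj; apply; rewrite !lfun_simp linearZ /= lker0_lfunVK //.
apply: (scalerI (dual_neq0 k (eta i))).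
rewrite -(pieceE _ _ fk) lker0_lfunVK // scalerA ffunE divff ?scale1r //.
exact: dual_neq0.
Qed.

End GradedPieces.

(** * The graded division algebra of a simple torus module *)

Section GradedDivision.
Variables (F : closedFieldType) (gT : finGroupType) (r : nat).
Variables (eta : 'I_r -> gT) (U : vectType F) (T : 'I_r -> 'End(U)).
Hypothesis eta_gen : <<[set eta i | i : 'I_r]>>%g = [set: gT].
Hypothesis T_inj : forall i, lker (T i) == 0%VS.
Hypothesis T_irr : irreducible_ops (fun s => exists i, s = T i).
Local Notation D := (piece eta T).
Implicit Types (k l : dual gT F) (f g : 'End(U)).

(** The kernel of f is stable under the T i. *)
Lemma piece_inj k f : f \in D k -> f != 0 -> lker f == 0%VS.
Proof.
move=> fk f0.
have stab s : (exists i, s = T i) -> (s @: lker f <= lker f)%VS.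
  case=> i ->; apply/subvP => _ /memv_imgP[u + ->]; rewrite !memv_ker => /eqP fu.
  have : k (eta i) *: f (T i u) = 0 by rewrite -(pieceE T_inj _ _ fk) fu linear0.
  by move/eqP; rewrite scaler_eq0 (negPf (dual_neq0 _ _)).
have [->//|fT] := T_irr.2 _ stab.
case/negP: f0; apply/eqP/lfunP => u; apply/eqP.
by rewrite zero_lfunE -memv_ker fT memvf.
Qed.

(** f^-1 g has degree 0, that is, commutes with the T i. *)
Lemma piece_line k f g : f \in D k -> f != 0 -> g \in D k -> exists c, g = c *: f.
Proof.
move=> fk f0 gk; have f_inj := piece_inj fk f0.
have fg0 : (f^-1 \o g)%VF \in D 0.
  by have := pieceM T_inj (pieceV T_inj f_inj fk) gk; rewrite addNr.
have [c fgc] : exists c, (f^-1 \o g)%VF = c *: \1%VF.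
  apply: schur_scalar T_irr _ => _ [i ->].
  by have /(pieceP eta T_inj)/(_ i) := fg0; rewrite ffunE scale1r.
by exists c; rewrite -[g](lker0_compVKf f_inj) fgc -comp_lfunZr comp_lfun1r.
Qed.

(* G is any set of degrees that contains 0 and those of the generators T i and
   is closed under addition; degrees outside G turn out not to occur. *)
Variable G : {pred dual gT F}.
Hypothesis G0 : 0 \in G.
Hypothesis GD : forall k l, k \in G -> l \in G -> k + l \in G.
Hypothesis GT : forall i, exists2 k, k \in G & T i \in D k.

(** The sum is an algebra of operators containing the T i, hence acts
    irreducibly, and Burnside's theorem applies. *)
Lemma pieces_full : (\sum_(k in G) D k)%VS = fullv.
Proof.
have pieceS k f : k \in G -> f \in D k -> f \in (\sum_(k in G) D k)%VS.
  by move=> kG; apply/subvP; rewrite (sumv_sup k).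
apply: burnside.
- by apply: pieceS G0 _; apply: piece1.
- move=> _ _ /memv_sumP[s sD ->] /memv_sumP[t tD ->].
  rewrite (big_morph (fun f => f \o _)%VF (fun f g => comp_lfunDl f g _)
    (comp_lfun0l _ _)).
  apply: rpred_sum => k kG.
  rewrite (big_morph (fun f => _ \o f)%VF (comp_lfunDr _) (comp_lfun0r _ _)).
  apply: rpred_sum => l lG; apply: (pieceS (k + l)); first exact: GD.
  exact: (pieceM T_inj (sD k kG) (tD l lG)).
- split=> [|W W_stable]; first exact: T_irr.1.
  apply: T_irr.2 => _ [i ->]; have [k kG Tk] := GT i.
  by apply: W_stable; apply: pieceS Tk.
Qed.

(** A piece of degree outside G is independent of the pieces in G, but these
    already fill the space of all operators. *)
Lemma piece_support k f : f \in D k -> f != 0 -> k \in G.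
Proof.
move=> fk; apply: contraNT => kG; apply/eqP.
pose c (l : dual gT F) i := l (eta i).
apply: (weight_space_indep (c := c) (G := G)) kG fk _.
  by move=> k1 k2; apply: dual_ext_gen eta_gen _ _ _.
by move: (memvf f); rewrite -pieces_full.
Qed.

End GradedDivision.

(** * Coverings by homogeneous operators *)

Section OperatorCoverings.
Variables (F : closedFieldType) (gT : finGroupType) (r : nat).
Variables (eta : 'I_r -> gT) (U M : vectType F).
Variables (TU : 'I_r -> 'End(U)) (TM : 'I_r -> 'End(M)).
Hypothesis TU_inj : forall i, lker (TU i) == 0%VS.
Hypothesis TM_inj : forall i, lker (TM i) == 0%VS.
Hypothesis TU_irr : irreducible_ops (fun s => exists i, s = TU i).
Hypothesis pieces_span : (\sum_k piece eta TU k)%VS = fullv.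
Variables (I : finType) (wt : I -> dual gT F).
Variables (inj : I -> 'Hom(U, M)) (prj : I -> 'Hom(M, U)).
(* M is a sum of copies of U indexed by I; the torus acts on the copy x as on U
   up to the character wt x. *)
Hypothesis prj_inj : forall x y u, prj x (inj y u) = if x == y then u else 0.
Hypothesis inj_prj : forall m, m = \sum_x inj x (prj x m).
Hypothesis TM_inj_eq :
  forall i x u, TM i (inj x u) = wt x (eta i) *: inj x (TU i u).
Local Notation D := (piece eta TU).
Local Notation E := (piece eta TM).
Implicit Types (g h k : dual gT F) (X Y : dual gT F -> {vspace M}) (n u : U).

Lemma prj_TM i x m : prj x (TM i m) = wt x (eta i) *: TU i (prj x m).
Proof.
rewrite {1}[m]inj_prj !linear_sum (bigD1 x) //= TM_inj_eq linearZ /=.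
rewrite prj_inj eqxx big1 ?addr0 // => y yx.
by rewrite TM_inj_eq linearZ /= prj_inj eq_sym (negPf yx) scaler0.
Qed.

Lemma entry_piece g f x y :
  f \in E g -> (prj x \o f \o inj y)%VF \in D (g + wt y - wt x).
Proof.
move=> fg; apply/(pieceP eta TU_inj) => i; apply/lfunP => u; rewrite !lfun_simp.
apply: (scalerI (dual_neq0 (wt x) (eta i))).
rewrite -prj_TM (pieceE TM_inj _ _ fg) TM_inj_eq !linearZ /= !scalerA.
by rewrite !ffunE divfK ?dual_neq0.
Qed.

Lemma matrix_unit_piece g f x y :
  f \in D (g + wt y - wt x) -> (inj x \o f \o prj y)%VF \in E g.
Proof.
move=> fg; apply/(pieceP eta TM_inj) => i; apply/lfunP => m.
rewrite !lfun_simp TM_inj_eq (pieceE TU_inj _ _ fg) prj_TM !linearZ /= !scalerA.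
by rewrite !ffunE divfK ?dual_neq0 // mulrC.
Qed.

Definition op_covering X : Prop :=
  (\sum_h X h)%VS = fullv /\
  forall g h f, f \in E g -> (f @: X h <= X (g + h)%R)%VS.

Lemma op_covering_shift X k :
  op_covering X -> op_covering (fun h => X (h + k)).
Proof.
case=> Xfull Xop; split=> [|g h f fg].
  by rewrite -[RHS]Xfull [RHS](reindex_inj (addIr k)).
by rewrite -addrA; apply: Xop.
Qed.

(** The degrees h - wt x run over a finite group, so the sum over exponents in
    Z^r of the theorem becomes a finite sum here. *)
Definition vector_covering n h : {vspace M} :=
  (\sum_x inj x @: (evalv n @: D (h - wt x)))%VS.

Lemma vector_coveringP n h m :
  reflect (forall x, exists2 f, f \in D (h - wt x) & prj x m = f n)
          (m \in vector_covering n h).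
Proof.
apply: (iffP idP) => [/memv_sumP[w wD ->] x | mD].
  have [_ /memv_imgP[f fD ->] wf] := memv_imgP (wD x isT).
  exists f => //; rewrite linear_sum (bigD1 x) //= wf prj_inj eqxx evalvE.
  rewrite big1 ?addr0 // => y yx.
  have [u _ ->] := memv_imgP (wD y isT).
  by rewrite prj_inj eq_sym (negPf yx).
rewrite [m]inj_prj; apply: memv_sumr => x _; apply: memv_img.
by have [f fD ->] := mD x; rewrite -evalvE memv_img.
Qed.

Lemma sub_vector_covering n h (W : {vspace M}) :
    (forall x f, f \in D (h - wt x) -> inj x (f n) \in W) ->
  (vector_covering n h <= W)%VS.
Proof.
move=> sW; apply/subv_sumP => x _; apply/subvP.
by move=> _ /memv_imgP[_ /memv_imgP[f fD ->] ->]; rewrite evalvE sW.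
Qed.

Lemma inj_vector_covering n h x f :
  f \in D (h - wt x) -> inj x (f n) \in vector_covering n h.
Proof.
move=> fD; apply: (subvP (sumv_sup x isT (subvv _))).
by rewrite memv_img // -evalvE memv_img.
Qed.

Lemma vector_covering_line n n' h :
  n \in <[n']>%VS -> (vector_covering n h <= vector_covering n' h)%VS.
Proof.
case/vlineP=> c ->; apply: sub_vector_covering => x f fD.
have -> : f (c *: n') = (c *: f) n' by rewrite scale_lfunE linearZ.
by rewrite inj_vector_covering ?memvZ.
Qed.

(** Extend the assignment n |-> u from the free family made of n alone. *)
Lemma lfun_transitive n u : n != 0 -> exists f : 'End(U), f n = u.
Proof.
move=> n0; have n_free : free [:: n] by rewrite seq1_free.
have [f fn] := linear_of_free [:: n] [:: u].
exists (linfun f); rewrite lfunE.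
by have := fn n_free erefl; case.
Qed.

(** The degree pieces of End(U) move n everywhere, which gives the sum; the
    entries of an operator of degree g and the D_k multiply degree by degree,
    which gives the shift. *)
Lemma vector_covering_covers n : n != 0 -> op_covering (vector_covering n).
Proof.
move=> n0; split.
  apply/eqP; rewrite eqEsubv subvf; apply/subvP => m _ /=.
  rewrite [m]inj_prj; apply: rpred_sum => x _.
  have [f <-] := lfun_transitive (prj x m) n0.
  have : f \in (\sum_k D k)%VS by rewrite pieces_span memvf.
  case/memv_sumP=> fk fD ->; rewrite sum_lfunE linear_sum.
  apply: rpred_sum => k _.
  apply: (subvP (sumv_sup (k + wt x) isT (subvv _))).
  by apply: inj_vector_covering; rewrite addrK fD.
move=> g h f fg; apply/subvP => _ /memv_imgP[m /vector_coveringP mD ->].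
apply/vector_coveringP => x.
have /choice[d dP] : forall y, exists d : 'End(U), d \in D (h - wt y) /\ prj y m = d n.
  by move=> y; have [d ? ?] := mD y; exists d.
exists (\sum_y ((prj x \o f \o inj y) \o d y)%VF).
  apply: rpred_sum => y _; have [dD _] := dP y.
  have -> : g + h - wt x = (g + wt y - wt x) + (h - wt y).
    by rewrite [g + wt y - _]addrAC [h - wt y]addrC addrA addrK addrAC.
  exact: (pieceM TU_inj (entry_piece x y fg) dD).
rewrite {1}[m]inj_prj sum_lfunE !linear_sum /=.
by apply: eq_bigr => y _; rewrite !lfun_simp -(dP y).2.
Qed.

(** Otherwise prj x would vanish on the whole sum, yet prj x o inj x = 1. *)
Lemma op_covering_hits X x :
    (fullv : {vspace U}) != 0%VS -> op_covering X ->
  exists h, exists2 m, m \in X h & prj x m != 0.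
Proof.
move=> U0 [Xfull _]; apply: contrapT => none.
have prj0 h m : m \in X h -> prj x m = 0.
  by move=> mX; apply/eqP; apply: contrapT => /negP m0; apply: none; exists h, m.
have [u u0] : exists u : U, u != 0.
  by exists (vpick fullv); rewrite vpick0.
have : inj x u \in (\sum_h X h)%VS by rewrite Xfull memvf.
case/memv_sumP=> w wX /(congr1 (prj x)); rewrite prj_inj eqxx linear_sum big1.
  by move/eqP; rewrite (negPf u0).
by move=> h _; apply: prj0 (wX h isT).
Qed.

(** Y contains some m with prj x m = d n nonzero, so d is invertible, and
    inj x o f d^-1 o prj x is homogeneous and sends m to inj x (f n). *)
Lemma vector_covering_minimal n Y :
    op_covering Y -> (forall h, (Y h <= vector_covering n h)%VS) ->
  forall h, Y h = vector_covering n h.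
Proof.
move=> Ycov sub_Y h; apply/eqP; rewrite eqEsubv sub_Y.
apply: sub_vector_covering => x f fD.
have [h' [m mY m0]] := op_covering_hits x TU_irr.1 Ycov.
have /vector_coveringP/(_ x)[d dD md] := subvP (sub_Y h') _ mY.
have d0 : d != 0 by apply: contraNneq m0 => d0; rewrite md d0 zero_lfunE.
have d_inj := piece_inj TU_inj TU_irr dD d0.
pose e := (inj x \o (f \o d^-1) \o prj x)%VF.
have eE : e \in E (h - h').
  apply: matrix_unit_piece; rewrite addrK.
  have -> : h - h' = (h - wt x) - (h' - wt x) by rewrite opprB addrA subrK.
  exact: (pieceM TU_inj fD (pieceV TU_inj d_inj dD)).
have -> : inj x (f n) = e m by rewrite !lfun_simp md lker0_lfunK.
have := subvP (Ycov.2 (h - h') h' e eE) _ (memv_img _ mY).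
by rewrite subrK.
Qed.

(** With m in X h0 and n = prj x0 m nonzero, the homogeneous operators
    inj x o f o prj x0 send m to all the generators of the covering of n; their
    degrees account for the shift by h0 - wt x0. *)
Lemma vector_covering_sub X :
    (fullv : {vspace M}) != 0%VS -> op_covering X ->
  exists2 n : U, n != 0 &
    exists k, forall h, (vector_covering n h <= X (h + k)%R)%VS.
Proof.
move=> M0 Xcov.
have [x0 _] : exists x0 : I, True.
  apply: contrapT => noI; case/negP: M0; rewrite -vpick0; apply/eqP.
  by rewrite [LHS]inj_prj big1 // => x _; case: noI; exists x.
have [h0 [m mX m0]] := op_covering_hits x0 TU_irr.1 Xcov.
exists (prj x0 m) => //; exists (h0 - wt x0) => h.
apply: sub_vector_covering => x f fD.
have eE : (inj x \o f \o prj x0)%VF \in E (h - wt x0).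
  by apply: matrix_unit_piece; rewrite subrK.
have := subvP (Xcov.2 _ _ _ eE) _ (memv_img _ mX).
by rewrite !lfun_simp addrAC -addrA.
Qed.

End OperatorCoverings.

(** * From the algebra to its operators *)

Section SimpleModule.
Variables (F : closedFieldType) (A : algType F).
Variables (M : vectType F) (rho : {linear A -> 'End(M)}).
Hypotheses (rho_module : is_module rho) (rho_simple : is_simple_module rho).

(** A may be infinite-dimensional; its image in End(M) is a finite-dimensional
    algebra to which Burnside's theorem applies. *)
Lemma simple_module_surj (f : 'End(M)) : exists a, rho a = f.
Proof.
pose S := vsum (fun a : A => <[rho a]>%VS).
have memS s : s \in S <-> exists a, rho a = s.
  split=> [/vsumP[as_]|[a <-]]; last first.
    by apply/vsumP; exists [:: a]; rewrite big_seq1 memv_line.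
  elim: as_ s => [|a as_ IHas] s.
    by rewrite big_nil memv0 => /eqP ->; exists 0; rewrite linear0.
  rewrite big_cons => /memv_addP[_ /vlineP[c ->] [t /IHas[b <-] ->]].
  by exists (c *: a + b); rewrite linearP.
have [rho1 rhoM] := rho_module.
apply/memS; suff -> : S = fullv by rewrite memvf.
apply: burnside.
- by apply/memS; exists 1.
- move=> _ _ /memS[a <-] /memS[b <-].
  by apply/memS; exists (a * b); rewrite rhoM.
- split=> [|W W_stable]; first exact: rho_simple.1.
  by apply: rho_simple.2 => a; apply/W_stable/memS; exists a.
Qed.

Variables (gT : finGroupType) (alpha : gT -> {lrmorphism A -> A}).
Hypothesis alpha_aut : is_aut_subgroup alpha.
Hypothesis char_gT : #|gT|%:R != 0 :> F.
Variables (r : nat) (eta : 'I_r -> gT) (T : 'I_r -> 'End(M)).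
Hypothesis eta_gen : <<[set eta i | i : 'I_r]>>%g = [set: gT].
Hypothesis T_inj : forall i, lker (T i) == 0%VS.
Hypothesis T_twist : forall i a,
  rho (alpha (eta i) a) = (T i \o rho a \o (T i)^-1)%VF.
Local Notation E := (piece eta T).

Lemma homogeneous_piece g a : homogeneous alpha g a -> rho a \in E g.
Proof.
move=> ag; apply/(pieceP eta T_inj) => i.
rewrite -[LHS](lker0_compfVK (T_inj i)) -T_twist ag linearZ /=.
by rewrite comp_lfunZl.
Qed.

(** Any preimage a of f satisfies rho (alpha s a) = g(s) f, first for the
    generators and then for all s; the average of g(s)^-1 alpha s a over s is a
    preimage homogeneous of degree g. *)
Lemma piece_homogeneous g f :
  f \in E g -> exists2 a, homogeneous alpha g a & rho a = f.
Proof.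
move=> fg; have [a0 rho_a0] := simple_module_surj f.
have rho_alpha s : forall a, rho a = f -> rho (alpha s a) = g s *: f.
  elim/(generated_ind eta_gen): s => [|s t IHs IHt|i] a rho_a.
  - by case: alpha_aut => -> _ _; rewrite dual1 scale1r.
  - case: alpha_aut => _ -> _ /=.
    have gt0 : g t != 0 by apply: dual_neq0.
    have -> : alpha t a = g t *: ((g t)^-1 *: alpha t a).
      by rewrite scalerA divff // scale1r.
    rewrite linearZ linearZ /= IHs; first by rewrite scalerA mulrC dualM.
    by rewrite linearZ /= IHt // scalerA mulVf // scale1r.
  - rewrite T_twist rho_a; have /(pieceP eta T_inj)-> := fg.
    by rewrite -comp_lfunZl lker0_compfK.
exists (#|gT|%:R^-1 *: \sum_s (g s)^-1 *: alpha s a0).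
  move=> t; rewrite linearZ linear_sum /= scalerA mulrC -scalerA; congr (_ *: _).
  rewrite scaler_sumr [RHS](reindex_inj (mulgI t)) /=; apply: eq_bigr => s _.
  rewrite linearZ scalerA dualM invfM mulrA divff ?mul1r ?dual_neq0 //.
  by case: alpha_aut => _ -> _.
rewrite linearZ linear_sum /= (eq_bigr (fun=> f)) => [|s _].
  rewrite sumr_const -scaler_nat scalerA.
  by rewrite mulVf ?scale1r.
by rewrite linearZ /= rho_alpha // scalerA mulVf ?scale1r ?dual_neq0.
Qed.

(** Only the operators matter: homogeneous elements of A and homogeneous
    operators on M correspond. *)
Lemma coveringE (X : dual gT F -> {vspace M}) :
  covering alpha rho X <-> op_covering eta T X.
Proof.
split=> -[Xfull Xop]; split=> // g h.
  by move=> f /piece_homogeneous[a ag <-]; apply: Xop.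
by move=> a /homogeneous_piece; apply: Xop.
Qed.

End SimpleModule.

(** * Restriction to the simple submodule *)

Section Restriction.
Variables (F : fieldType) (M : vectType F) (N : {vspace M}).
Implicit Types (f g : 'End(M)) (u : subvs_of N).

Fact restrict_is_linear f : linear (restrict (N := N) f).
Proof. by move=> c u v; rewrite /restrict !linearP. Qed.

HB.instance Definition _ f :=
  GRing.isLinear.Build F (subvs_of N) (subvs_of N) _ (restrict f)
    (restrict_is_linear f).

Definition restrict_lfun f : 'End(subvs_of N) := linfun (restrict (N := N) f).

Lemma restrict_lfunE f u :
  (f @: N <= N)%VS -> vsval (restrict_lfun f u) = f (vsval u).
Proof.
move=> fN; rewrite lfunE /= /restrict vsprojK //.
by apply: (subvP fN); rewrite memv_img ?subvsP.
Qed.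

Lemma restrict_lfun_inj f :
  (f @: N <= N)%VS -> lker f == 0%VS -> lker (restrict_lfun f) == 0%VS.
Proof.
move=> fN /lker0P f_inj; apply/lker0P => u v /(congr1 vsval).
by rewrite !restrict_lfunE // => /f_inj/subvs_inj.
Qed.

Lemma restrict_lfun_twist f g c :
    (f @: N <= N)%VS -> (g @: N <= N)%VS -> (f \o g)%VF = c *: (g \o f)%VF ->
  (restrict_lfun f \o restrict_lfun g)%VF
    = c *: (restrict_lfun g \o restrict_lfun f)%VF.
Proof.
move=> fN gN /lfunP fg; apply/lfunP => u; apply: subvs_inj.
rewrite comp_lfunE !restrict_lfunE // -comp_lfunE fg !scale_lfunE !comp_lfunE.
by rewrite -!restrict_lfunE.
Qed.

End Restriction.

Section SimpleSubmodule.
Variables (F : closedFieldType) (M : vectType F) (r : nat).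
Variables (T : 'I_r -> 'End(M)) (N : {vspace M}).
Hypothesis T_inj : forall i, lker (T i) == 0%VS.
Hypothesis N_simple : qsimple T N.

(** Subspaces of N stable under the T i are also stable under their inverses,
    for dimension reasons, so they are torus submodules. *)
Lemma restrict_irreducible :
  irreducible_ops (fun s => exists i, s = restrict_lfun N (T i)).
Proof.
have [Nsub N0 Nmin] := N_simple; split=> [|W W_stable].
  apply: contraNneq N0 => NT; rewrite -subv0; apply/subvP => u uN.
  have := memvf (vsproj N u); rewrite NT memv0 => /eqP u0.
  by rewrite -(vsprojK uN) u0 mem0v.
pose j : 'Hom(subvs_of N, M) := linfun vsval.
have j_inj : lker j == 0%VS.
  by apply/lker0P => u v; rewrite !lfunE => /subvs_inj.
have jW_N : (j @: W <= N)%VS.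
  by apply/subvP => _ /memv_imgP[w _ ->]; rewrite lfunE subvsP.
have TjW i : (T i @: (j @: W) <= j @: W)%VS.
  apply/subvP => _ /memv_imgP[_ /memv_imgP[w wW ->] ->].
  rewrite lfunE /= -restrict_lfunE; last by have [] := Nsub i.
  have -> : vsval (restrict_lfun N (T i) w) = j (restrict_lfun N (T i) w).
    by rewrite [RHS]lfunE.
  rewrite memv_img //; apply: (subvP (W_stable _ _)) (memv_img _ wW).
  by exists i.
have TjW_eq i : (T i @: (j @: W))%VS = (j @: W)%VS.
  apply/eqP; rewrite eqEdim TjW (limg_dim_eq (f := T i)) ?leqnn //.
   by rewrite (eqP (T_inj i)) capv0.
have jW_sub : qsubmodule T (j @: W)%VS.
  move=> i; split=> //; rewrite -{1}(TjW_eq i) -limg_comp.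
  by rewrite lker0_compVf // lim1g.
have [jW0|jWN] := Nmin _ jW_sub jW_N; [left | right].
  by apply/eqP; rewrite -(eq_limg_ker0 _ _ j_inj) jW0 limg0.
apply/eqP; rewrite -(eq_limg_ker0 _ _ j_inj) jWN eqEsubv.
apply/andP; split; apply/subvP => x; last first.
  by case/memv_imgP=> u _ ->; rewrite lfunE subvsP.
move=> xN; have -> : x = j (vsproj N x) by rewrite lfunE /= vsprojK.
by rewrite memv_img ?memvf.
Qed.

End SimpleSubmodule.

(** * Monomials in the torus generators *)

Section Monomials.
Variables (F : fieldType) (M : vectType F).
Implicit Types (f g : 'End(M)) (U : {vspace M}).

Lemma comp_lfun_inj f g :
  lker f == 0%VS -> lker g == 0%VS -> lker (f \o g)%VF == 0%VS.
Proof.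
move=> /lker0P f_inj /lker0P g_inj; apply/lker0P => u v.
by rewrite !comp_lfunE => /f_inj/g_inj.
Qed.

Lemma lfunV_inj f : lker f == 0%VS -> lker (f^-1)%VF == 0%VS.
Proof.
by move=> f_inj; apply/lker0P; apply: can_inj (lker0_lfunVK f_inj).
Qed.

Lemma twist_comp f g h c d :
    (f \o g = c *: (g \o f))%VF -> (f \o h = d *: (h \o f))%VF ->
  (f \o (g \o h) = (c * d) *: ((g \o h) \o f))%VF.
Proof.
move=> /lfunP fg /lfunP fh; apply/lfunP => u.
have := fg (h u); have := fh u; rewrite !lfun_simp => -> ->.
by rewrite linearZ scalerA.
Qed.

Lemma twist_inv f g c : lker g == 0%VS -> c != 0 ->
  (f \o g = c *: (g \o f))%VF -> (f \o g^-1 = c^-1 *: (g^-1 \o f))%VF.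
Proof.
move=> g_inj c0 fg; apply: (scalerI c0); rewrite scalerA divff // scale1r.
rewrite -[LHS](lker0_compKf g_inj); congr (_ \o _)%VF.
rewrite -comp_lfunZr comp_lfunA comp_lfunZl -fg lker0_compfK //.
Qed.

(** The conditions on g that pass to products, and hence from the generators
    to all monomials. *)
Record twisted_by U f (c : F) g : Prop := TwistedBy {
  twisted_inj : lker g == 0%VS;
  twisted_stable : (g @: U <= U)%VS;
  twisted_eq : (f \o g = c *: (g \o f))%VF
}.

Lemma twisted_by1 U f : twisted_by U f 1 \1%VF.
Proof.
split; last by rewrite scale1r comp_lfun1l comp_lfun1r.
  by apply/lker0P => u v; rewrite !id_lfunE.
by rewrite lim1g.
Qed.

Lemma twisted_byM U f c d g h :
  twisted_by U f c g -> twisted_by U f d h -> twisted_by U f (c * d) (g \o h)%VF.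
Proof.
move=> [g_inj gU fg] [h_inj hU fh]; split; first exact: comp_lfun_inj.
  by rewrite limg_comp; apply: subv_trans gU; apply: limgS.
exact: twist_comp.
Qed.

Lemma twisted_by_iter U f c g n :
  twisted_by U f c g -> twisted_by U f (c ^+ n) (iter n (comp_lfun g) \1%VF).
Proof.
move=> fg; elim: n => [|n IHn]; first exact: twisted_by1.
by rewrite exprS iterS; apply: twisted_byM.
Qed.

(** Negative powers are powers of the inverse, which inherits the conditions
    with c^-1 in place of c. *)
Lemma twisted_by_expz U f c g z :
    c != 0 -> twisted_by U f c g -> (g^-1 @: U <= U)%VS ->
  twisted_by U f (c ^ z) (lfun_expz g z).
Proof.
move=> c0 fg gVU; case: z => n; first exact: twisted_by_iter.
rewrite NegzE -exprnN -exprVn; apply: twisted_by_iter.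
have [g_inj gU fgE] := fg.
by split; [apply: lfunV_inj | | apply: twist_inv].
Qed.

Lemma twisted_by_monomial r (T : 'I_r -> 'End(M)) U f (c : 'I_r -> F)
    (a : {ffun 'I_r -> int}) :
    (forall i, c i != 0) -> (forall i, twisted_by U f (c i) (T i)) ->
    (forall i, ((T i)^-1 @: U <= U)%VS) ->
  twisted_by U f (\prod_i c i ^ a i) (monomial T a).
Proof.
move=> c0 fT TV; rewrite /monomial.
elim/big_rec2: _ => [|i g d _ IH]; first exact: twisted_by1.
by apply: twisted_byM IH; apply: twisted_by_expz.
Qed.

End Monomials.

(** * Coordinates on the isotypic decomposition *)

Section DirectSum.
Variables (F : fieldType) (M : vectType F) (I : finType) (W : I -> vectType F).
Variable iota : forall i, 'Hom(W i, M).
Hypothesis iota_inj : forall i, lker (iota i) == 0%VS.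
Hypothesis iota_direct : directv (\sum_i limg (iota i))%VS.
Hypothesis iota_full : (\sum_i limg (iota i))%VS = fullv.

(** The inverse of iota i after projection on the i-th summand. *)
Definition component (i : I) : 'Hom(M, W i) :=
  ((iota i)^-1 \o sumv_pi_for (esym iota_full) i)%VF.

Lemma iota_component i m :
  iota i (component i m) = sumv_pi_for (esym iota_full) i m.
Proof. by rewrite comp_lfunE limg_lfunVK // memv_sum_pi. Qed.

Lemma component_sum m : m = \sum_i iota i (component i m).
Proof.
under eq_bigr do rewrite iota_component.
by rewrite sumv_pi_sum ?memvf.
Qed.

Lemma component_uniq (w : forall i, W i) i :
  component i (\sum_j iota j (w j)) = w i.
Proof.
have /lker0P := iota_inj i; apply; apply/eqP; rewrite -subr_eq0; apply/eqP.
set m := \sum_j _.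
apply: (directv_sum_independent iota_direct
          (fun j => iota j (component j m) - iota j (w j))) => // [j _|].
  by rewrite rpredB ?memv_img ?memvf.
by rewrite sumrB -component_sum subrr.
Qed.

Lemma component_iota i (w : W i) : component i (iota i w) = w.
Proof.
(* The family that is w at i and 0 elsewhere; W depends on the index, hence the
   transport. *)
pose w' j : W j := if i =P j is ReflectT e then ecast j (W j) e w else 0.
have w'i : w' i = w.
  by rewrite /w'; case: eqP => // e; rewrite (eq_axiomK e).
rewrite -[in RHS]w'i -(component_uniq w' i) (bigD1 i) //= w'i big1 ?addr0 //.
move=> j ji; rewrite /w'; case: eqP => [e|_]; last exact: linear0.
by rewrite e eqxx in ji.
Qed.

Lemma component_iota0 i j (w : W j) : i != j -> component i (iota j w) = 0.
Proof.
pose w' k : W k := if j =P k is ReflectT e then ecast k (W k) e w else 0.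
have w'j : w' j = w.
  by rewrite /w'; case: eqP => // e; rewrite (eq_axiomK e).
have w'0 k : k != j -> w' k = 0.
  by rewrite /w'; case: eqP => // e; rewrite {1}e eqxx.
move=> ij; rewrite -(w'0 i ij) -(component_uniq w' i) (bigD1 j) //= w'j.
by rewrite big1 ?addr0 // => k kj; rewrite w'0 ?linear0.
Qed.

End DirectSum.

Section TensorCoordinates.
Variables (F : fieldType) (U W : vectType F).

Definition basis_vect (j : 'I_(dim W)) : W := r2v (delta_mx 0 j).

Definition tens_right (w : W) (u : U) : tensor U W := tens u w.

HB.instance Definition _ (w : W) :=
  GRing.isLinear.Build F U (tensor U W) _ (tens_right w) (@tens_is_linearl F U W w).

Lemma tensZ c u w : tens (c *: u) w = tens u (c *: w) :> tensor U W.
Proof. by rewrite [RHS]linearZ -[LHS]/(tens_right w (c *: u)) linearZ. Qed.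

(** In matrix terms the coordinate of t along the j-th basis vector of W is
    the j-th column of t. *)
Definition tens_coord (j : 'I_(dim W)) (t : tensor U W) : U :=
  r2v (col j (t : 'M_(_, _)))^T.

Fact tens_coord_is_linear j : linear (tens_coord j).
Proof. by move=> c t t'; rewrite /tens_coord !linearP. Qed.

HB.instance Definition _ j :=
  GRing.isLinear.Build F (tensor U W) U _ (tens_coord j) (tens_coord_is_linear j).

Lemma tens_coord_tens j u w : tens_coord j (tens u w) = v2r w 0 j *: u.
Proof.
rewrite -[u in RHS]v2rK -linearZ /tens_coord /tens; congr (r2v _).
by apply/rowP => i; rewrite !mxE big_ord1 !mxE mulrC.
Qed.

Lemma tens_coord_sum (t : tensor U W) :
  t = \sum_j tens (tens_coord j t) (basis_vect j).
Proof.
apply/matrixP => i j; rewrite summxE (bigD1 j) //= big1 => [|k kj].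
  by rewrite /tens /tens_coord !r2vK !mxE big_ord1 !mxE !eqxx mulr1 addr0.
by rewrite /tens /tens_coord !r2vK !mxE big_ord1 !mxE eqxx eq_sym (negPf kj) mulr0.
Qed.

End TensorCoordinates.

Section Coordinates.
Variables (F : closedFieldType) (gT : finGroupType) (M : vectType F) (r : nat).
Variables (eta : 'I_r -> gT) (T : 'I_r -> 'End(M)) (N : {vspace M}).
Variable V : dual gT F -> vectType F.
Variable iota : forall h, 'Hom(tensor (subvs_of N) (V h), M).
Hypothesis decomp : isotypic_decomposition eta T iota.

(** One index for each basis vector of each V h, that is, for each copy of N. *)
Definition coord_index : finType := {h : dual gT F & 'I_(dim (V h))}.
Implicit Types x y : coord_index.

Definition copy_inj x : 'Hom(subvs_of N, M) :=
  (iota (tag x) \o linfun (tens_right (basis_vect (tagged x))))%VF.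

Definition copy_prj x : 'Hom(M, subvs_of N) :=
  (linfun (tens_coord (tagged x)) \o component (decomp_full decomp) (tag x))%VF.

Lemma copy_injE h (j : 'I_(dim (V h))) u :
  copy_inj (Tagged _ j) u = iota h (tens u (basis_vect j)).
Proof. by rewrite comp_lfunE lfunE. Qed.

Lemma copy_prj_iota h (j : 'I_(dim (V h))) t :
  copy_prj (Tagged _ j) (iota h t) = tens_coord j t.
Proof.
rewrite comp_lfunE component_iota ?lfunE //.
  exact: decomp_inj decomp.
exact: decomp_direct decomp.
Qed.

Lemma copy_prj_iota0 x h t : tag x != h -> copy_prj x (iota h t) = 0.
Proof.
move=> xh; rewrite comp_lfunE component_iota0 ?linear0 //.
  exact: decomp_inj decomp.
exact: decomp_direct decomp.
Qed.

Lemma copy_prj_inj x y u : copy_prj x (copy_inj y u) = if x == y then u else 0.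
Proof.
case: y => k j; rewrite copy_injE; case: x => h i.
have [hk|hk] := eqVneq h k; last first.
  by rewrite copy_prj_iota0 // -tag_eqE /tag_eq (negPf hk).
case: _ / hk j => j; rewrite copy_prj_iota tens_coord_tens r2vK mxE.
rewrite -tag_eqE /tag_eq /= eqxx tagged_asE /= eq_sym.
by case: eqP => _; rewrite ?scale1r ?scale0r.
Qed.

Lemma copy_inj_prj m : m = \sum_x copy_inj x (copy_prj x m).
Proof.
rewrite {1}(component_sum (decomp_full decomp) m).
under eq_bigr => h _ do rewrite [X in iota h X]tens_coord_sum linear_sum.
rewrite sig_big_dep /=; apply: eq_bigr => -[h j] _ /=.
rewrite copy_injE; congr (iota h (tens _ _)).
by rewrite [RHS]comp_lfunE [RHS]lfunE.
Qed.

Lemma copy_inj_action i x u :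
  T i (copy_inj x u)
    = tag x (eta i) *: copy_inj x (restrict_lfun N (T i) u).
Proof.
case: x => h j; rewrite !copy_injE (decomp_action decomp) /=.
by rewrite linearZ linearZ /= [restrict_lfun _ _ _]lfunE.
Qed.

End Coordinates.

(** * The coverings attached to vectors of the simple submodule *)

Section TorusCovering.
Variables (F : closedFieldType) (gT : finGroupType) (M : vectType F) (r : nat).
Variables (eta : 'I_r -> gT) (q : 'I_r -> 'I_r -> F) (T : 'I_r -> 'End(M)).
Hypothesis eta_gen : <<[set eta i | i : 'I_r]>>%g = [set: gT].
Hypothesis T_module : is_qtorus_module q T.
Variable N : {vspace M}.
Hypothesis N_simple : qsimple T N.
Variable gamma : {additive {ffun 'I_r -> int} -> dual gT F}.
Hypothesis gammaE : forall a b : {ffun 'I_r -> int},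
  gamma a (\prod_(i < r) expgz (eta i) (b i))%g
    = \prod_(i < r) \prod_(j < r) q i j ^ (a i * b j).
Implicit Types a b : {ffun 'I_r -> int}.

Let T_inj : forall i, lker (T i) == 0%VS := T_module.1.
Let TU i := restrict_lfun N (T i).
Let D := piece eta TU.

(** Exchanging T i and T j twice multiplies a nonzero operator by this scalar. *)
Lemma qtorus_scalarV i j : q i j * q j i = 1.
Proof.
have [_ TT] := T_module; have [_ N0 _] := N_simple.
have TT_inj : lker (T i \o T j)%VF == 0%VS by apply: comp_lfun_inj.
have TT0 : (T i \o T j)%VF != 0.
  apply: contraNneq N0 => TT0; rewrite -subv0 -(eqP TT_inj) TT0.
  by apply/subvP => u _; rewrite memv_ker zero_lfunE.
apply/eqP; rewrite -subr_eq0 -(orbF (_ == 0)) -(negPf TT0) -scaler_eq0.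
by rewrite scalerBl scale1r -scalerA -TT -TT subrr.
Qed.

Lemma qtorus_scalar_neq0 i j : q i j != 0.
Proof.
apply: contraTneq (oner_neq0 F) => q0.
by rewrite -(qtorus_scalarV i j) q0 mul0r eqxx.
Qed.

(** Evaluate the formula for gamma at the j-th unit vector. *)
Lemma gamma_eta a j : gamma a (eta j) = \prod_i q i j ^ a i.
Proof.
have := gammaE a [ffun i => (i == j)%:Z].
have -> : (\prod_(i < r) expgz (eta i) ([ffun i => (i == j)%:Z] i))%g = eta j.
  rewrite (eq_bigr (fun i => if i == j then eta i else 1%g)) => [|i _].
    by rewrite -big_mkcond big_pred1_eq.
  by rewrite ffunE; case: eqP => _ /=; rewrite ?expg1 ?expg0.
move=> ->; apply: eq_bigr => i _.
rewrite (bigD1 j) //= ffunE eqxx mulr1 big1 ?mulr1 // => k kj.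
by rewrite ffunE (negPf kj) mulr0 expr0z.
Qed.

Lemma monomial_twisted a j :
  twisted_by N (T j) (\prod_i q j i ^ a i) (monomial T a).
Proof.
have [Nsub _ _] := N_simple.
apply: twisted_by_monomial => i; first exact: qtorus_scalar_neq0.
  by split; [exact: T_inj | have [] := Nsub i | exact: T_module.2].
by have [] := Nsub i.
Qed.

Lemma restrict_T_inj i : lker (TU i) == 0%VS.
Proof.
have [Nsub _ _] := N_simple.
by apply: restrict_lfun_inj; [have [] := Nsub i | exact: T_inj].
Qed.

Lemma restrict_T_irr : irreducible_ops (fun s => exists i, s = TU i).
Proof. exact: restrict_irreducible T_inj N_simple. Qed.

(** Moving T j through T^a costs the product of the q j i ^ a i, which is the
    inverse of gamma a (eta j) because q j i and q i j are inverse. *)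
Lemma restrict_monomial_piece a : restrict_lfun N (monomial T a) \in D (- gamma a).
Proof.
apply/(pieceP eta restrict_T_inj) => j.
have [_ aN aT] := monomial_twisted a j; have [Nsub _ _] := N_simple.
have -> : (- gamma a) (eta j) = \prod_i q j i ^ a i.
  rewrite ffunE gamma_eta -prodfV; apply: eq_bigr => i _.
  rewrite invr_expz -exprz_inv; congr (_ ^ _).
  by rewrite -[LHS]mul1r -(qtorus_scalarV j i) mulfK ?qtorus_scalar_neq0.
by apply: restrict_lfun_twist aT => //; have [] := Nsub j.
Qed.

Lemma restrict_monomial_neq0 a : restrict_lfun N (monomial T a) != 0.
Proof.
have [Nsub _ _] := N_simple.
have [a_inj aN _] : twisted_by N \1%VF (\prod_i 1 ^ a i) (monomial T a).
  apply: twisted_by_monomial => i; first exact: oner_neq0.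
    split; [exact: T_inj | by have [] := Nsub i |].
    by rewrite scale1r comp_lfun1l comp_lfun1r.
  by have [] := Nsub i.
apply: contraNneq restrict_T_irr.1 => a0.
rewrite -subv0 -(eqP (restrict_lfun_inj aN a_inj)) a0.
by apply/subvP => u _; rewrite memv_ker zero_lfunE.
Qed.

(* The degrees of monomials, a subgroup of the character group. *)
Let G := [pred k : dual gT F | `[< exists a, k = - gamma a >]].

Let memG k : reflect (exists a, k = - gamma a) (k \in G).
Proof. exact: asboolP. Qed.

Let G0 : 0 \in G.
Proof. by apply/memG; exists 0; rewrite raddf0 oppr0. Qed.

Let GD k l : k \in G -> l \in G -> k + l \in G.
Proof.
move=> /memG[a ->] /memG[b ->]; apply/memG; exists (a + b).
by rewrite raddfD opprD.
Qed.

Let GT i : exists2 k, k \in G & TU i \in D k.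
Proof.
pose a : {ffun 'I_r -> int} := [ffun j => (j == i)%:Z].
exists (- gamma a); first by apply/memG; exists a.
have [Nsub _ _] := N_simple.
apply/(pieceP eta restrict_T_inj) => j.
have -> : (- gamma a) (eta j) = q j i.
  rewrite ffunE gamma_eta (bigD1 i) //= ffunE eqxx expr1z big1 => [|k ki].
    by rewrite mulr1 -[LHS]mul1r -(qtorus_scalarV j i) mulfK ?qtorus_scalar_neq0.
  by rewrite ffunE (negPf ki) expr0z.
apply: restrict_lfun_twist; last exact: T_module.2.
  by have [] := Nsub j.
by have [] := Nsub i.
Qed.

Lemma torus_pieces_full : (\sum_k D k)%VS = fullv.
Proof.
apply/eqP; rewrite eqEsubv subvf.
rewrite -(pieces_full restrict_T_inj restrict_T_irr G0 GD GT).
by apply/subv_sumP => k _; apply: sumv_sup (subvv _).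
Qed.

(** Only degrees of monomials occur, and each piece is a line. *)
Lemma piece_monomial k f :
    f \in D k -> f != 0 ->
  exists a c, k = - gamma a /\ f = c *: restrict_lfun N (monomial T a).
Proof.
move=> fk f0.
have /memG[a ka] := piece_support eta_gen restrict_T_inj restrict_T_irr G0 GD GT fk f0.
have aD := restrict_monomial_piece a; rewrite -ka in aD.
have [c fc] := piece_line restrict_T_inj restrict_T_irr aD
  (restrict_monomial_neq0 a) fk.
by exists a, c.
Qed.

Variable V : dual gT F -> vectType F.
Variable iota : forall h, 'Hom(tensor (subvs_of N) (V h), M).
Hypothesis decomp : isotypic_decomposition eta T iota.

(** The summand of exponent a sits in the copies of degree h + gamma a, where it
    fills D_(- gamma a)(n) = D_(h - wt x)(n); conversely a nonzero element of
    D_(h - wt x) is a multiple of a monomial T^a with wt x = h + gamma a. *)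
Lemma torus_coveringE (n : subvs_of N) h :
  torus_covering T iota gamma n h
    = vector_covering eta TU (fun x : coord_index V => tag x)
        (copy_inj iota) n h.
Proof.
apply/eqP; rewrite eqEsubv; apply/andP; split.
  apply/subvP => m /vsumP[s]; apply: subvP m.
  elim: s => [|a s IHs]; first by rewrite big_nil sub0v.
  rewrite big_cons subv_add IHs andbT.
  apply/subvP => _ /memv_imgP[_ /memv_imgP[v _ ->] ->].
  rewrite lfunE /=.
  apply/(vector_coveringP eta TU _ (copy_prj_inj decomp) (copy_inj_prj decomp)) => x.
  have [hx|hx] := eqVneq (tag x) (h + gamma a); last first.
    by exists 0; rewrite ?mem0v // copy_prj_iota0 ?zero_lfunE.
  case: x hx => k j /= hk; move: v j; rewrite -hk => v j.
  exists (v2r v 0 j *: restrict_lfun N (monomial T a)).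
    by rewrite memvZ // hk opprD addNKr restrict_monomial_piece.
  by rewrite copy_prj_iota tens_coord_tens scale_lfunE [in RHS]lfunE.
apply: sub_vector_covering => -[k j] f /= fD.
have [->|f0] := eqVneq f 0; first by rewrite zero_lfunE linear0 mem0v.
have [a [c [hk ->]]] := piece_monomial fD f0.
have {hk} kE : k = h + gamma a by rewrite -[gamma a]opprK -hk subKr.
subst k; apply/vsumP; exists [:: a]; rewrite big_seq1 copy_injE.
rewrite scale_lfunE [restrict_lfun _ _ _]lfunE /=.
apply: memv_img.
by rewrite tensZ /tens_line -[tens _ _]lfunE memv_img ?memvf.
Qed.

End TorusCovering.

Theorem theorem3p17 (R : realType) (A : algType R[i])
    (M : vectType R[i]) (rho : {linear A -> 'End(M)})
    (rho_module : is_module rho) (rho_simple : is_simple_module rho)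
    (Hhat : finGroupType) (alpha : Hhat -> {lrmorphism A -> A})
    (alpha_aut : is_aut_subgroup alpha)
    (Hhat_abelian : abelian [set: Hhat])
    (twist_iso : forall s : Hhat, module_iso (twist rho (alpha s)) rho)
    (r : nat) (eta : 'I_r -> Hhat)
    (eta_gen : <<[set eta i | i : 'I_r]>>%g = [set: Hhat])
    (q : 'I_r -> 'I_r -> R[i]) (T : 'I_r -> 'End(M))
    (T_module : is_qtorus_module q T)
    (T_twist : forall i a,
       rho (alpha (eta i) a) = (T i \o rho a \o (T i)^-1)%VF)
    (N : {vspace M}) (N_simple : qsimple T N)
    (V : dual Hhat R[i] -> vectType R[i])
    (iota : forall h, 'Hom(tensor (subvs_of N) (V h), M))
    (decomp : isotypic_decomposition eta T iota)
    (gamma : {additive {ffun 'I_r -> int} -> dual Hhat R[i]})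
    (gammaE : forall a b : {ffun 'I_r -> int},
       gamma a (\prod_(i < r) expgz (eta i) (b i))%g
         = \prod_(i < r) \prod_(j < r) q i j ^ (a i * b j)) :
  [/\ forall n : subvs_of N, n != 0 ->
        thin_covering alpha rho (torus_covering T iota gamma n),
      forall n n' : subvs_of N, n != 0 -> n' != 0 -> <[n]>%VS = <[n']>%VS ->
        torus_covering T iota gamma n =1 torus_covering T iota gamma n'
    & forall X : dual Hhat R[i] -> {vspace M}, thin_covering alpha rho X ->
        exists2 n : subvs_of N, n != 0
          & equiv_covering X (torus_covering T iota gamma n)].
Proof.
pose TU i := restrict_lfun N (T i).
have T_inj := T_module.1.
have TU_inj := restrict_T_inj T_module N_simple.
have TU_irr := restrict_T_irr T_module N_simple.
have char_Hhat : #|Hhat|%:R != 0 :> R[i].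
  by rewrite Num.Theory.pnatr_eq0 -lt0n; apply/card_gt0P; exists 1%g.
have covE := coveringE rho_module rho_simple alpha_aut char_Hhat eta_gen T_inj T_twist.
have pi := copy_prj_inj decomp; have ip := copy_inj_prj decomp.
have act := copy_inj_action decomp.
have full := torus_pieces_full T_module N_simple gammaE.
have torusE n : torus_covering T iota gamma n =
    vector_covering eta TU (fun x : coord_index V => tag x) (copy_inj iota) n.
  by apply/funext => h;
    apply: (torus_coveringE eta_gen T_module N_simple gammaE decomp).
have cov n : n != 0 -> covering alpha rho (torus_covering T iota gamma n).
  by move=> n0; rewrite torusE; apply/covE;
     apply: (vector_covering_covers TU_inj T_inj full pi ip act n0).
split=> [n n0 | n n' _ _ nn' h | X [Xcov Xthin]].
- split=> [|Y Ycov sub_Y h]; first exact: cov.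
  rewrite torusE; apply: (vector_covering_minimal TU_inj T_inj TU_irr pi ip act).
    exact/covE.
  by move=> k; rewrite -torusE.
- have nN' : n \in <[n']>%VS by rewrite -nn' memv_line.
  have n'N : n' \in <[n]>%VS by rewrite nn' memv_line.
  by apply/eqP; rewrite !torusE eqEsubv !vector_covering_line.
- have [n n0 [k sub_X]] :=
    vector_covering_sub TU_inj T_inj TU_irr pi ip act rho_simple.1 ((covE X).1 Xcov).
  exists n => //; exists (- k) => h.
  symmetry; apply: Xthin (fun h => torus_covering T iota gamma n (h - k)) _ _ h.
    by apply/covE/op_covering_shift/covE/cov.
  by move=> h'; rewrite torusE -{2}[h'](subrK k).
Qed.
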